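(* Let $k$ be a field, fix an integer $t \geq 1$, and let $\Gamma$ be a tree on the $n$ vertices $V_\Gamma=\{x_1,\ldots,x_n\}$, with partial $t$-cover ideal $J_t(\Gamma)\subseteq R=k[x_1,\ldots,x_n]$. Then for all integers $s \geq 1$, \[{\rm Ass}(J_t(\Gamma)^s) = \left\{ P = \langle x_{i_0},x_{i_1},\ldots,x_{i_r} \rangle ~\left|~ \Gamma_P = K_{1,r} \mbox{ with } t \leq r \leq \min\{n,s(t-1)+1\}\right.\right\}.\]
   Context: Graphs are finite and simple. A graph is called a tree if it has no induced cycles. For a vertex $x$ of a graph $G=(V_G,E_G)$, $N(x)=\{y ~|~ \{x,y\}\in E_G\}$. Vertices $x_i$ are identified with the variables $x_i$ of $R=k[x_1,\ldots,x_n]$. For an integer $t\geq 1$, the partial $t$-cover ideal of $G$ is the monomial ideal \[J_t(G) = \bigcap_{x \in V_G} \left(\bigcap_{\{x_{i_1},\ldots,x_{i_t}\} \subseteq N(x)} \langle x,x_{i_1},\ldots,x_{i_t} \rangle \right),\] where the inner intersection runs over all $t$-element subsets of $N(x)$ (an empty intersection of ideals is $R$). For an ideal $I\subseteq R$, a prime ideal $P$ is an associated prime of $I$ if $P = I:\langle T\rangle$ for some $T\in R$, and ${\rm Ass}(I)$ is the set of all associated primes of $I$. For $P=\langle x_{i_0},\ldots,x_{i_r}\rangle$ generated by $r+1$ distinct variables, $P$ also denotes the vertex set $\{x_{i_0},\ldots,x_{i_r}\}$, and $\Gamma_P$ is the induced subgraph of $\Gamma$ on this set. $K_{1,r}$ is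 the star graph: one central vertex joined to each of $r$ other vertices, with no other edges; $\Gamma_P=K_{1,r}$ means that $\Gamma_P$ is isomorphic to $K_{1,r}$. *)

(* Defs.v *)
From mathcomp Require Import all_boot all_algebra.
From mathcomp Require Import classical_sets.
From mathcomp Require Import mpoly.

Set Implicit Arguments.
Unset Strict Implicit.
Unset Printing Implicit Defensive.

Import GRing.Theory.
Local Open Scope ring_scope.

(** * Finite simple graphs *)

Record sgraph (V : finType) := SGraph {
  adj : rel V;
  adj_sym : ssrbool.symmetric adj;
  adj_irr : irreflexive adj
}.

Definition nbhd (V : finType) (G : sgraph V) (x : V) : {set V} :=
  [set y | adj G x y]%SET.

Definition graph_iso (V W : finType) (G : sgraph V) (H : sgraph W) : Prop :=
  exists2 f : V -> W, bijective f & forall x y, adj H (f x) (f y) = adj G x y.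

Section Induced.
Variables (V : finType) (G : sgraph V) (U : {set V}).

Definition induced_adj : rel {x : V | x \in U} :=
  fun x y => adj G (val x) (val y).

Lemma induced_adj_sym : ssrbool.symmetric induced_adj.
Proof. by move=> x y; apply: adj_sym. Qed.

Lemma induced_adj_irr : irreflexive induced_adj.
Proof. by move=> x; apply: adj_irr. Qed.

Definition induced : sgraph {x : V | x \in U} :=
  SGraph induced_adj_sym induced_adj_irr.
End Induced.

(** [star r] is K_{1,r}, with centre [ord0]. *)
Section Star.
Variable r : nat.

Definition star_adj : rel 'I_r.+1 := fun i j => (i == ord0) != (j == ord0).

Lemma star_adj_sym : ssrbool.symmetric star_adj.
Proof. by move=> i j; rewrite /star_adj eq_sym. Qed.

Lemma star_adj_irr : irreflexive star_adj.
Proof. by move=> i; rewrite /star_adj eqxx. Qed.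

Definition star : sgraph 'I_r.+1 := SGraph star_adj_sym star_adj_irr.
End Star.

(** [cycle_graph m] is the cycle C_m only when [3 <= m]: [ordS] is the cyclic
    successor, and [i != j] only matters for [m = 1]. *)
Section Cycle.
Variable m : nat.

Definition cycle_adj : rel 'I_m :=
  fun i j => (i != j) && ((j == ordS i) || (i == ordS j)).

Lemma cycle_adj_sym : ssrbool.symmetric cycle_adj.
Proof. by move=> i j; rewrite /cycle_adj eq_sym orbC. Qed.

Lemma cycle_adj_irr : irreflexive cycle_adj.
Proof. by move=> i; rewrite /cycle_adj eqxx. Qed.

Definition cycle_graph : sgraph 'I_m := SGraph cycle_adj_sym cycle_adj_irr.
End Cycle.

(** Connectedness is not required: a tree is a graph with no induced cycle. *)
Definition is_tree (V : finType) (G : sgraph V) : Prop :=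
  forall (m : nat) (U : {set V}),
    (3 <= m)%N -> ~ graph_iso (induced G U) (cycle_graph m).

(** * Ideals, as sets of ring elements *)

Local Open Scope classical_set_scope.

Section Ideals.
Variable R : comNzRingType.
Implicit Types I J P A : set R.

(** Unlike [idealr_closed], this allows the unit ideal. *)
Definition is_ideal I : Prop :=
  [/\ I 0, (forall f g, I f -> I g -> I (f + g)) &
      (forall a f, I f -> I (a * f))].

Definition is_prime_ideal P : Prop :=
  idealr_closed (mem P) /\ prime_idealr_closed (mem P).

Definition ideal_gen A : set R := smallest is_ideal A.

Definition ideal_mul I J : set R :=
  ideal_gen [set h | exists f g, [/\ I f, J g & h = f * g]].

Definition ideal_exp I (s : nat) : set R := iter s (ideal_mul I) setT.

Definition colon I J : set R := [set f | forall g, J g -> I (f * g)].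

Definition Ass I : set (set R) :=
  [set P | is_prime_ideal P /\ exists T : R, P = colon I (ideal_gen [set T])].
End Ideals.

(** * Partial cover ideals *)

Section PartialCover.
Variables (k : fieldType) (n : nat).

Definition var_ideal (S : {set 'I_n}) : set {mpoly k[n]} :=
  ideal_gen [set f | exists2 i : 'I_n, i \in S & f = 'X_i].

Definition partial_cover_ideal (t : nat) (G : sgraph 'I_n) :
    set {mpoly k[n]} :=
  \bigcap_(x in [set: 'I_n])
    \bigcap_(A in [set A : {set 'I_n} | A \subset nbhd G x /\ #|A| = t])
      var_ideal (x |: A)%SET.
End PartialCover.

Arguments var_ideal k {n} S.
Arguments partial_cover_ideal k {n} t G.

(* Main.v *)
Require Import Defs.
From mathcomp Require Import classical_sets boolp mpoly.
From mathcomp Require Import all_boot all_algebra zify ring.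

(** Write J for the partial t-cover ideal and a for an exponent vector.

    The monomials of J^s.  A squarefree monomial lies in J exactly when no
    vertex of the complement D of its support has t neighbours in D, so x^a lies
    in J^s exactly when some s such sets D_1, ..., D_s have every vertex x in at
    least s - a_x of them: this is a colouring of the forest in which x receives
    s - a_x colours (truncated subtraction) and no colour class has a vertex
    of degree t or more.  Two adjacent vertices x and y are forced to share
    s - (a_x + a_y) colours, and a colour of x may be shared with at most t - 1
    neighbours, so a colouring requires, at every x,
      sum over the neighbours y of x of s - (a_x + a_y)  <=  (t - 1)(s - a_x).
    On a forest this is also sufficient ([balanced_colouring]): add the
    vertices one at a time, each with at most one neighbour already present,
    share with that neighbour as few colours as possible, and choose its least
    used ones.  The load on the colours of each vertex stays balanced, so the
    averaged inequality bounds every single load.  Hence J^s is the monomial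
    ideal cut out by these inequalities ([power_partial_cover_ideal]).

    Reading off the associated primes.  An associated prime of a monomial ideal
    is generated by a set S of variables ([associated_prime_monomial]), and for
    J^s it comes from an exponent a with large entries outside S, violating the
    inequalities, and satisfying them as soon as any entry indexed by S is
    increased by one.  The inequality violated by a sits at some x, and the
    only entries whose increase affects it are those of x and of the neighbours
    y with a_x + a_y < s; so S consists of x and these neighbours, which in a
    forest form a star.
    The violation is moreover by exactly one, so the left side is
    (t - 1)(s - a_x) + 1, a sum of #|S| - 1 terms between 1 and s - a_x, which
    gives the two bounds on the size of S ([critical_star]).  Conversely, for
    a star within these bounds, a_x = 0 and suitable terms with that sum
    give such an exponent ([critical_exponent]). *)

Set Implicit Arguments.
Unset Strict Implicit.
Unset Printing Implicit Defensive.

(** * Leaves of forests *)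

Section Forest.
Variables (V : finType) (G : sgraph V).

(** The cycle is given as a list of its vertices in cyclic order; only index
    pairs [i < j] are constrained, the rest being symmetry. *)
Lemma induced_cycle_not_tree (x0 : V) (c : seq V) :
    uniq c -> 3 <= size c ->
    (forall i j, i < j < size c ->
       adj G (nth x0 c i) (nth x0 c j) =
       (j == i.+1) || ((i == 0) && (j.+1 == size c))) ->
  ~ is_tree G.
Proof.
move=> Uc c3 cE /(_ (size c) [set x in c] c3); apply.
have ltf (z : {x | x \in [set x in c]}) : index (val z) c < size c.
  by rewrite index_mem; case: z => z /=; rewrite inE.
pose f z := Ordinal (ltf z).
have nthf z : nth x0 c (f z) = val z by rewrite nth_index // -index_mem ltf.
have f_inj : injective f.
  by move=> y z e; apply: val_inj; rewrite -[LHS]nthf e nthf.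
have lt_adj y z : f y < f z ->
  cycle_adj (f y) (f z) = adj G (val y) (val z).
  move=> ltyz; have := cE (f y) (f z); rewrite ltyz ltn_ord !nthf => /(_ isT) ->.
  rewrite /cycle_adj neq_ltn ltyz /=.
  congr (_ || _).
    by rewrite -val_eqE /= modn_small //; apply: leq_ltn_trans (ltn_ord (f z)).
  rewrite -val_eqE /=; have := ltn_ord (f z); rewrite leq_eqVlt => /orP[/eqP e|lt].
    by rewrite -/(f z) -/(f y) e modnn eqxx andbT.
  rewrite modn_small // (ltn_eqF lt) andbF; apply/eqP => e.
  by move: ltyz; rewrite /= e ltnNge leqnSn.
exists f.
  apply: inj_card_bij f_inj _.
  rewrite card_ord card_sig.
  have -> : #|[pred x | x \in [set x in c]]| = #|c| by apply: eq_card => z; rewrite !inE.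
  by rewrite (card_uniqP Uc).
move=> y z /=; rewrite /induced_adj.
case: (ltngtP (f y) (f z)) => [/lt_adj //|/lt_adj e|/val_inj e].
  by rewrite cycle_adj_sym adj_sym.
by rewrite e cycle_adj_irr (f_inj _ _ e) adj_irr.
Qed.

Lemma tree_triangle_free x y z :
  is_tree G -> adj G x y -> adj G x z -> adj G y z = false.
Proof.
move=> treeG xy xz; apply/negP => yz.
apply: (@induced_cycle_not_tree x [:: x; y; z]) treeG => //.
  rewrite /= !inE negb_or andbT; apply/andP; split; first (apply/andP; split).
  - by apply: contraL xy => /eqP ->; rewrite adj_irr.
  - by apply: contraL xz => /eqP ->; rewrite adj_irr.
  - by apply: contraL yz => /eqP ->; rewrite adj_irr.
by case=> [|[|[|i]]] [|[|[|j]]] /andP[] //= _ _; rewrite ?xy ?xz ?yz.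
Qed.

Definition induced_path (x0 : V) (p : seq V) :=
  uniq p /\ forall i j, i < j < size p ->
    adj G (nth x0 p i) (nth x0 p j) = (j == i.+1).

(** If the first vertex of an induced path has a second neighbour [w] in [U],
    either [w] extends the path to a longer induced path, or the first
    neighbour of [w] further along the path closes an induced cycle.  A path
    cannot be extended forever, so in a forest some end of it is a leaf. *)
Lemma tree_induced_path_leaf (x0 : V) (U : {set V}) (p : seq V) :
    is_tree G -> {subset x0 :: p <= U} -> induced_path x0 (x0 :: p) ->
  exists2 v, v \in U & #|nbhd G v :&: U| <= 1.
Proof.
move=> treeG; have [m] := ubnP (#|V| - size p).
elim: m x0 p => // m IHm x0 p ltm sU [Up pE].
have x0U : x0 \in U by apply: sU; rewrite mem_head.
have [//|deg2] := leqP #|nbhd G x0 :&: U| 1; first by exists x0.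
have adj0 v i : i < size p -> adj G x0 (nth v p i) = (i == 0).
  move=> lti; have := pE 0 i.+1; rewrite /= !ltnS lti => /(_ isT).
  by rewrite (set_nth_default v).
have [w wN wp] : exists2 w, w \in nbhd G x0 :&: U & w \notin x0 :: p.
  apply/exists_inP; rewrite -negb_forall_in; apply: contraL deg2.
  move=> /forall_inP Np; rewrite -leqNgt.
  rewrite -(cards1 (head x0 p)).
  apply: subset_leq_card; apply/subsetP => w wN; rewrite inE.
  have := Np w wN; rewrite inE => /orP[/eqP w0|wp].
    by move: wN; rewrite w0 !inE adj_irr.
  have := wN; rewrite !inE => /andP[+ _].
  rewrite -{1}(nth_index x0 wp) adj0 ?index_mem // => /eqP i0.
  by rewrite -nth0 -i0 nth_index.
have [x0w wU] : adj G x0 w /\ w \in U by move: wN; rewrite !inE => /andP[].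
have [hasw|noadj] := boolP (has (adj G w) p); last first.
  apply: (IHm w (x0 :: p)).
  - have : size (x0 :: p) <= #|V| by rewrite -(card_uniqP Up) max_card.
    by move: ltm => /=; lia.
  - by move=> z; rewrite inE => /orP[/eqP-> //|]; apply: sU.
  split; first by rewrite cons_uniq wp.
  case=> [|i] [|j] //= ltij; last first.
    rewrite !(set_nth_default x0 w) ?pE //=; move: ltij => /=; lia.
  case: j ltij => [|j] /= ltj; first by rewrite adj_sym x0w.
  apply/negP => wj; case/hasP: noadj; exists (nth w p j) => //.
  exact: mem_nth.
(* [k] is the earliest index in [p] of a neighbour of [w]: earliest so that
   the cycle through [w] has no chord. *)
exfalso; pose k := find (adj G w) p.
have ltkp : k < size p by rewrite -has_find.
apply: (@induced_cycle_not_tree x0 (w :: x0 :: take k.+1 p)) treeG => //.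
- apply: subseq_uniq (_ : uniq (w :: x0 :: p)); last by rewrite cons_uniq wp.
  by rewrite /= !eqxx take_subseq.
- by rewrite /= size_takel.
rewrite /= size_takel // => -[|i] [|j] //=; rewrite ltnS => ltij; last first.
  have [ltj ltjk] : i < j < size (x0 :: p) /\ j < k.+2.
    move: ltij => /andP[? ?]; rewrite /=; split; lia.
  rewrite orbF eqSS -pE //; case: i j {ltij} ltj ltjk => [|i] [|j] //= ltij ltjk.
    by rewrite nth_take.
  by rewrite !nth_take //; move: ltij ltjk; lia.
case: j ltij => [|j] /= ltj; first by rewrite adj_sym x0w.
rewrite nth_take //; have [e|ne] := eqVneq j k.
  by rewrite e nth_find // !eqSS eqxx.
rewrite !eqSS (negPf ne) before_find //; lia.
Qed.

Lemma tree_leaf (U : {set V}) :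
  is_tree G -> U != set0 -> exists2 v, v \in U & #|nbhd G v :&: U| <= 1.
Proof.
move=> treeG /set0Pn [x xU]; apply: (@tree_induced_path_leaf x _ [::]) => //.
  by move=> z; rewrite inE => /eqP ->.
by split=> // -[|i] [|j] /andP[].
Qed.

End Forest.

(** * Balanced colourings *)

Lemma least_loaded_subset (T : finType) (f : T -> nat) (A : {set T}) (e : nat) :
    e <= #|A| ->
  exists E : {set T}, [/\ E \subset A, #|E| = e &
    forall c d, c \in E -> d \in A :\: E -> f c <= f d].
Proof.
elim: e => [|e IHe] le_eA.
  by exists set0; rewrite sub0set cards0; split=> // c d; rewrite inE.
have [E [sEA cE leE]] := IHe (ltnW le_eA).
have /card_gt0P [d0 d0P] : 0 < #|A :\: E|.
  by rewrite cardsD (setIidPr sEA) cE subn_gt0.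
pose d := [arg min_(d < d0 in A :\: E) f d].
have [dP dmin] : d \in A :\: E /\ forall c, c \in A :\: E -> f d <= f c.
  by rewrite /d; case: arg_minnP.
move: (dP); rewrite inE => /andP[dE dA].
exists (d |: E); split; first by rewrite subUset sub1set dA.
  by rewrite cardsU1 dE cE.
move=> c c'; rewrite !inE negb_or => /orP[/eqP ->|cE'] /andP[/andP[_ c'E] c'A].
  by apply: dmin; rewrite inE c'E.
by apply: leE => //; rewrite inE c'E.
Qed.

Lemma card_subset_exists (T : finType) (A : {set T}) (e : nat) :
  e <= #|A| -> exists2 E : {set T}, E \subset A & #|E| = e.
Proof. by case/(least_loaded_subset (fun=> 0)) => E [sE cE _]; exists E. Qed.

Section Colouring.
Variables (V : finType) (G : sgraph V) (s : nat) (b : V -> nat).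

Definition load (U : {set V}) (B : V -> {set 'I_s}) (x : V) (c : 'I_s) : nat :=
  #|[set y in U | adj G x y && (c \in B y)]|.

(** Every vertex receives the prescribed number of colours, adjacent vertices
    share as few as these numbers allow, and the sharing is spread evenly over
    the colours of each vertex. *)
Definition balanced_on (U : {set V}) (B : V -> {set 'I_s}) : Prop :=
  [/\ forall x, x \in U -> #|B x| = b x,
      forall x y, x \in U -> y \in U -> adj G x y ->
        #|B x :&: B y| = b x + b y - s &
      forall x c d, x \in U -> c \in B x -> d \in B x ->
        load U B x c <= (load U B x d).+1].

(** Giving the leaf [v] the colours [D] raises by one the load at its neighbour
    [x] of each colour in [D]; this keeps the loads of [x] within one of each
    other because the colours taken from [x] are its least loaded ones.  At [v]
    itself the loads are at most one. *)
Lemma extend_balanced (U : {set V}) (v : V) (B : V -> {set 'I_s}) (D : {set 'I_s}) :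
    v \in U -> balanced_on (U :\ v) B -> #|D| = b v ->
    #|nbhd G v :&: U| <= 1 ->
    (forall x, x \in U -> adj G x v ->
       #|B x :&: D| = b x + b v - s /\
       forall c d, c \in B x :&: D -> d \in B x :\: D ->
         load (U :\ v) B x c <= load (U :\ v) B x d) ->
  balanced_on U (fun x => if x == v then D else B x).
Proof.
move=> vU [cB eB lB] cD leaf xP; set B' := fun x => _.
have B'v : B' v = D by rewrite /B' eqxx.
have B'E x : x != v -> B' x = B x by rewrite /B' => /negPf ->.
have loadE x c : x != v ->
  load U B' x c = (adj G x v && (c \in D)) + load (U :\ v) B x c.
  move=> xv; rewrite /load (cardsD1 v) !inE vU B'v; congr (_ + _).
  apply: eq_card => y; rewrite !inE; have [//|yv] := eqVneq y v.
  by rewrite B'E.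
have Uv x : x \in U -> x != v -> x \in U :\ v by move=> xU xv; rewrite !inE xv.
split.
- move=> x xU; have [->|xv] := eqVneq x v; first by rewrite B'v.
  by rewrite B'E // cB // Uv.
- move=> x y xU yU xy; have [ex|xv] := eqVneq x v; last first.
    have [ey|yv] := eqVneq y v; last by rewrite !B'E // eB // Uv.
    by rewrite ey B'v B'E //; move: xy; rewrite ey => /xP[].
  have yv : y != v by apply: contraL xy => /eqP ->; rewrite ex adj_irr.
  rewrite ex B'v B'E // setIC addnC; move: xy.
  by rewrite ex adj_sym => /xP[].
move=> x c d xU; have [->|xv] := eqVneq x v => [_ _|].
  apply: leq_trans (_ : 1 <= _) => //; apply: leq_trans leaf.
  apply: subset_leq_card; apply/subsetP => y; rewrite !inE.
  by case/and3P => -> ->.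
rewrite B'E // !loadE // => cx dx; have xU' := Uv _ xU xv.
have := lB x c d xU' cx dx; case: (boolP (adj G x v)) => //= /xP-/(_ xU)[_ min].
have := min c d; rewrite !inE cx dx /=.
case: (c \in D); case: (d \in D) => //=; last by lia.
by move=> /(_ isT isT).
Qed.

Hypothesis b_le : forall x, b x <= s.

Lemma balanced_colouring : is_tree G -> exists B, balanced_on [set: V] B.
Proof.
move=> treeG; move: [set: V] => U; have [m] := ubnP #|U|.
elim: m U => // m IHm U; rewrite ltnS => leUm.
have [->|/(tree_leaf treeG) [v vU leaf]] := eqVneq U set0.
  by exists (fun=> set0); split=> x; rewrite inE.
have [|B balB] := IHm (U :\ v).
  by rewrite (leq_trans _ leUm) // [X in _ < X](cardsD1 v) vU.
have [noN|[x xN]] := set_0Vmem (nbhd G v :&: U).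
  have [|D _ cD] := @card_subset_exists _ [set: 'I_s] (b v).
    by rewrite cardsT card_ord.
  exists (fun x => if x == v then D else B x); apply: extend_balanced => //.
  move=> x xU xv; have : x \in nbhd G v :&: U by rewrite !inE adj_sym xv.
  by rewrite noN inE.
have [vx xU] : adj G v x /\ x \in U by move: xN; rewrite !inE => /andP[].
have cBx : #|B x| = b x.
  case: balB => cB _ _; apply: cB; rewrite !inE xU andbT.
  by apply: contraL vx => /eqP ->; rewrite adj_irr.
have le_b := b_le.
(* [E] is what [v] has to share with [x]; the colours [F] that it still needs
   fit outside those of [x]. *)
have [|E [sE cE minE]] :=
    @least_loaded_subset _ (load (U :\ v) B x) (B x) (b x + b v - s).
  by have := le_b v; rewrite cBx; lia.
have [|F sF cF] := @card_subset_exists _ (~: B x) (b v - (b x + b v - s)).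
  by have := cardsC (B x); have := le_b x; rewrite card_ord cBx; lia.
have EI : B x :&: (E :|: F) = E.
  apply/setP => c; rewrite !inE; have := subsetP sE c; have := subsetP sF c.
  rewrite !inE; case: (c \in E) => [_ -> //|]; case: (c \in F) => //=.
    by move=> /(_ isT) /negPf ->.
  by rewrite andbF.
have ED : B x :\: (E :|: F) = B x :\: E.
  apply/setP => c; rewrite !inE; have := subsetP sF c; rewrite inE.
  by case: (c \in F); case: (c \in E); case: (c \in B x) => //= /(_ isT).
exists (fun x => if x == v then E :|: F else B x); apply: extend_balanced => //.
  have dEF : E :&: F = set0.
    apply/setP => c; rewrite !inE; have := subsetP sE c; have := subsetP sF c.
    by rewrite !inE; case: (c \in E); case: (c \in F) => //= /(_ isT)/negPf-> /(_ isT).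
  by rewrite cardsU dEF cards0 cE cF; have := le_b x; lia.
move=> y yU yv; have -> : y = x.
  have /card_le1_eqP := leaf; apply=> //.
  by rewrite !inE adj_sym yv.
by rewrite EI ED cE.
Qed.

End Colouring.

(** * Exponent vectors of powers of the cover ideal *)

Lemma sum_supported (T : finType) (A B : {set T}) (F : T -> nat) :
    A \subset B -> (forall y, y \in B :\: A -> F y = 0) ->
  \sum_(y in B) F y = \sum_(y in A) F y.
Proof.
by move=> sAB F0; rewrite (big_setID A) /= (setIidPr sAB) [X in _ + X]big1 ?addn0.
Qed.

Lemma leq_sum_subset (T : finType) (A B : {set T}) (F : T -> nat) :
  A \subset B -> \sum_(y in A) F y <= \sum_(y in B) F y.
Proof. by move=> sAB; rewrite [X in _ <= X](big_setID A) /= (setIidPr sAB) leq_addr. Qed.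

Section StarCondition.
Variables (V : finType) (G : sgraph V) (t : nat).

(** A linear form of the inequalities, in which monotonicity and additivity in
    [a] are evident; [star_condP] is the form with one inequality per vertex.
    For [#|A| < t] the truncated subtraction makes the inequality trivial. *)
Definition star_cond (s : nat) (a : V -> nat) : Prop :=
  forall (x : V) (A : {set V}), A \subset nbhd G x ->
    (#|A| - t.-1) * s <= (#|A| - t.-1) * a x + \sum_(y in A) a y.

Definition deficient (s : nat) (a : V -> nat) (x : V) : {set V} :=
  [set y in nbhd G x | a x + a y < s].

Lemma deficient_sub s a x : deficient s a x \subset nbhd G x.
Proof. by apply/subsetP => y; rewrite inE => /andP[]. Qed.

Lemma sum_deficient s a b x : (forall z, a z <= b z) ->
  \sum_(y in nbhd G x) (s - (b x + b y)) =
  \sum_(y in deficient s a x) (s - (b x + b y)).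
Proof.
move=> leab; apply: sum_supported; first exact: deficient_sub.
move=> y; rewrite !inE; have := leab x; have := leab y.
by case: (adj G x y); lia.
Qed.

(** At a vertex [x] the strongest of the linear inequalities is the one for
    the set of neighbours [y] with [a x + a y < s]. *)
Lemma star_condP s a :
  star_cond s a <->
  forall x, \sum_(y in nbhd G x) (s - (a x + a y)) <= t.-1 * (s - a x).
Proof.
split=> [sa x|sa x A sA].
  rewrite (sum_deficient _ _ (a := a)) //; set A := deficient s a x.
  have sA : A \subset nbhd G x by apply: deficient_sub.
  have sumE : \sum_(y in A) (s - (a x + a y)) + (#|A| * a x + \sum_(y in A) a y) = #|A| * s.
    rewrite -!sum_nat_const -!big_split /=; apply: eq_bigr => y.
    by rewrite inE => /andP[_ lt]; rewrite subnK // ltnW.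
  have [leA|ltA] := leqP #|A| t.-1.
    apply: leq_trans (_ : #|A| * (s - a x) <= _); last by rewrite leq_mul2r leA orbT.
    by rewrite -sum_nat_const; apply: leq_sum => y _; rewrite leq_sub2l // leq_addr.
  have := sa x A sA; move: sumE; rewrite -{2 3}(subnK (ltnW ltA)) !mulnDl mulnBr.
  lia.
have [leA|ltA] := leqP #|A| t.-1; first by rewrite (eqP leA).
have [lesx|ltxs] := leqP s (a x).
  by apply: leq_trans (leq_addr _ _); rewrite leq_mul2l lesx orbT.
have sumE : #|A| * s <= \sum_(y in A) (s - (a x + a y)) + (#|A| * a x + \sum_(y in A) a y).
  rewrite -!sum_nat_const -!big_split /=; apply: leq_sum => y _; lia.
have sumA : \sum_(y in A) (s - (a x + a y)) <= t.-1 * (s - a x).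
  by apply: leq_trans (sa x); apply: leq_sum_subset.
move: sumE sumA; rewrite -{1 3}(subnK (ltnW ltA)) !mulnDl mulnBr.
have : t.-1 * a x <= t.-1 * s by rewrite leq_mul2l (ltnW ltxs) orbT.
lia.
Qed.

Lemma star_condW s a a' :
  (forall x, a x <= a' x) -> star_cond s a -> star_cond s a'.
Proof.
move=> le sa x A sA; apply: leq_trans (sa x A sA) _.
by apply: leq_add; [rewrite leq_mul2l le orbT | apply: leq_sum].
Qed.

Lemma star_condD s s' a a' : star_cond s a -> star_cond s' a' ->
  star_cond (s + s') (fun x => a x + a' x).
Proof.
move=> sa sa' x A sA; rewrite big_split /= !mulnDr addnACA.
exact: leq_add (sa x A sA) (sa' x A sA).
Qed.

(** Membership of a monomial in the cover ideal: [a] is positive somewhere on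
    every set of a vertex and [t] of its neighbours. *)
Definition meets_stars (a : V -> nat) : Prop :=
  forall (x : V) (A : {set V}), A \subset nbhd G x -> #|A| = t ->
    exists2 y, y \in x |: A & 0 < a y.

Hypothesis t_gt0 : 0 < t.

(** If [a x = 0], fewer than [t] of the neighbours of [x] have a zero entry. *)
Lemma meets_stars_cond a : meets_stars a -> star_cond 1 a.
Proof.
move=> ca x A sA; have [ax|ax] := posnP (a x); last first.
  by apply: leq_trans (leq_addr _ _); rewrite leq_mul2l ax orbT.
rewrite muln1 ax muln0 add0n leq_subLR.
have -> : #|A| = #|[set y in A | a y == 0]| + \sum_(y in A) (0 < a y).
  rewrite -!sum1_card [LHS](bigID (fun y => a y == 0)) /=; congr (_ + _).
    by apply: eq_bigl => y; rewrite inE.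
  by rewrite big_mkcondr /=; apply: eq_bigr => y _; rewrite -lt0n; case: ltnP.
apply: leq_add; last by apply: leq_sum => y _; case: (a y).
rewrite -ltnS prednK // ltnNge; apply/negP => /card_subset_exists [D sD cD].
have [|//|y] := ca x D.
  by apply: subset_trans sD _; apply/subsetP => y; rewrite inE => /andP[/(subsetP sA)].
rewrite in_setU1 => /predU1P[->|/(subsetP sD)]; first by rewrite ax.
by rewrite inE => /andP[_ /eqP ->].
Qed.

(** The s covers are the complements of the colour classes of a balanced
    colouring with [s - a x] colours at [x].  If a class contained [x] and [t]
    of its neighbours, that colour would have load at least [t] at [x], hence
    every colour of [x] load at least [t - 1], and the total load would exceed
    the bound of [star_condP]. *)
Lemma star_cond_decomposition s a : is_tree G -> star_cond s a ->
  exists C : 'I_s -> {set V},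
    (forall j, meets_stars (fun x => x \in C j)) /\
    forall x, \sum_(j < s) (x \in C j) <= a x.
Proof.
move=> treeG /star_condP sa.
have [|B [cB eB lB]] := balanced_colouring (b := fun x => s - a x) (s := s) _ treeG.
  by move=> x; apply: leq_subr.
exists (fun j => [set x | j \notin B x]); split=> [j x A sA cA|x]; last first.
  have -> : \sum_(j < s) (x \in [set x | j \notin B x]) = #|~: B x|.
    rewrite -sum1_card [RHS]big_mkcond; apply: eq_bigr => j _.
    by rewrite !inE; case: (j \in B x).
  have := cardsC (B x); rewrite card_ord cB ?inE //; lia.
apply/exists_inP; apply: contraT; rewrite negb_exists_in => /forall_inP noC.
have inB y : y \in x |: A -> j \in B y.
  by move=> /noC; rewrite inE; case: (j \in B y).
have jx : j \in B x by apply: inB; rewrite setU11.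
have loadE c : load G [set: V] B x c = \sum_(y in nbhd G x) (c \in B y).
  rewrite /load -sum1_card [RHS]big_mkcond [LHS]big_mkcond; apply: eq_bigr => y _.
  by rewrite !inE; case: (adj G x y); case: (c \in B y).
have load_j : t <= load G [set: V] B x j.
  rewrite -cA; apply: subset_leq_card; apply/subsetP => y yA.
  have := subsetP sA y yA; rewrite !inE => -> /=; apply: inB.
  by rewrite in_setU1 yA orbT.
have : \sum_(c in B x) load G [set: V] B x c <= t.-1 * #|B x|.
  rewrite (eq_bigr _ (fun c _ => loadE c)) exchange_big /= cB ?inE //.
  rewrite (eq_bigr (fun y => s - (a x + a y))) // => y.
  rewrite inE => xy; have := eB x y; rewrite !inE => /(_ isT isT xy) => eBxy.
  transitivity #|B x :&: B y|; last by rewrite eBxy; lia.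
  rewrite -sum1_card [RHS]big_mkcond [LHS]big_mkcond; apply: eq_bigr => c _.
  by rewrite inE; case: (c \in B x); case: (c \in B y).
rewrite leqNgt (bigD1 j) //= (cardsD1 j) jx mulnDr muln1 mulnC -sum_nat_const.
move=> /negP[]; rewrite -addSn; apply: leq_add; first by rewrite prednK.
under [X in _ <= X]eq_bigl => c do rewrite andbC -in_setD1.
apply: leq_sum => c; rewrite in_setD1 => /andP[_ cx].
have := lB x j c; rewrite inE => /(_ isT jx cx); lia.
Qed.

(** * Critical exponents *)

(** Let [x] be a vertex where the inequality fails.  Increasing an entry outside
    [x |: deficient s a x] does not affect it, so [S] lies in this set, and
    entries that are at least [s] are neither [a x] nor deficient, so the two
    are equal.  Increasing the entry of one deficient neighbour lowers the left
    side by at most one, so the violation is by exactly one. *)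
Lemma critical_star s a (S : {set V}) :
    (forall i, i \in S -> star_cond s (fun z => (z == i) + a z)) ->
    (forall j, j \notin S -> s <= a j) -> ~ star_cond s a ->
  exists (x : V) (A : {set V}),
    [/\ A \subset nbhd G x, S = x |: A & t <= #|A| <= t.-1 * s + 1].
Proof.
move=> satS big_out /star_condP nsa.
have [x] : exists x, t.-1 * (s - a x) < \sum_(y in nbhd G x) (s - (a x + a y)).
  apply/existsP; apply: contra_notT nsa; rewrite negb_exists => /forallP nx x.
  by rewrite leqNgt nx.
pose A := deficient s a x.
have sA : A \subset nbhd G x by apply: deficient_sub.
have sumA i : \sum_(y in nbhd G x) (s - ((x == i) + a x + ((y == i) + a y))) =
              \sum_(y in A) (s - ((x == i) + a x + ((y == i) + a y))).
  by rewrite (sum_deficient _ _ (a := a) (b := fun z => (z == i) + a z)) // => z; apply: leq_addl.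
rewrite (sum_deficient _ _ (a := a)) // -/A.
move=> viol.
have /set0Pn [y yA] : A != set0.
  by apply: contraTneq viol => ->; rewrite big_set0 -leqNgt.
have yx : x != y.
  by apply: contraTneq (subsetP sA y yA) => ->; rewrite inE adj_irr.
have SE : S = x |: A.
  apply/eqP; rewrite eqEsubset; apply/andP; split; apply/subsetP => i.
    move=> iS; have /star_condP/(_ x) := satS i iS; rewrite sumA in_setU1.
    apply: contraTT; rewrite negb_or => /andP[ix iA].
    rewrite -ltnNge eq_sym (negPf ix); apply: leq_trans viol _.
    rewrite leq_eqVlt; apply/orP; left; apply/eqP; apply: eq_bigr => z zA.
    by rewrite (_ : (z == i) = false) //; apply: contraNF iA => /eqP <-.
  rewrite in_setU1; apply: contraTT => /big_out lei; rewrite negb_or; apply/andP; split.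
    apply: contraTneq viol => ix; rewrite -leqNgt -ix big1 // => z _; lia.
  by rewrite inE; lia.
exists x, A; split=> //; apply/andP; split.
  rewrite leqNgt; apply: contraL viol => ltA; rewrite -leqNgt.
  apply: leq_trans (_ : #|A| * (s - a x) <= _); last by rewrite leq_mul2r -ltnS prednK // ltA orbT.
  by rewrite -sum_nat_const; apply: leq_sum => z _; rewrite leq_sub2l // leq_addr.
have /star_condP/(_ x) : star_cond s (fun z => (z == y) + a z).
  by apply: satS; rewrite SE in_setU1 yA orbT.
rewrite sumA (negPf yx) add0n => sat.
have le1 : #|A| <= \sum_(z in A) (s - (a x + a z)).
  rewrite -sum1_card; apply: leq_sum => z; rewrite inE => /andP[_]; lia.
have le2 : \sum_(z in A) (s - (a x + a z)) <=
           1 + \sum_(z in A) (s - (a x + ((z == y) + a z))).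
  rewrite (bigD1 y) //= [X in _ <= _ + X](bigD1 y) //= eqxx addnA.
  apply: leq_add; first lia.
  by apply: leq_sum => z /andP[_ /negPf ->].
apply: leq_trans le1 _; apply: leq_trans le2 _; rewrite addnC leq_add2r.
by apply: leq_trans sat _; rewrite leq_mul2l leq_subr orbT.
Qed.

Lemma bounded_weights (A : {set V}) s N : #|A| <= N <= #|A| * s ->
  exists c : V -> nat, (forall y, y \in A -> 0 < c y <= s) /\ \sum_(y in A) c y = N.
Proof.
elim: N => [|N IHN].
  rewrite leqn0 cards_eq0 => /andP[/eqP-> _]; exists (fun=> 0).
  by split=> [y|]; rewrite ?inE ?big_set0.
case/andP; rewrite leq_eqVlt => /predU1P[eA|ltA] ltN.
  exists (fun=> 1); split; last by rewrite sum1_card.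
  move=> y yA /=; rewrite lt0n; apply: contraTneq ltN => ->.
  by rewrite muln0.
have [|c [cA sumc]] := IHN; first by rewrite -ltnS ltA ltnW.
have [y yA cy] : exists2 y, y \in A & c y < s.
  apply/exists_inP; apply: contraLR ltN; rewrite negb_exists_in => /forall_inP no.
  rewrite -leqNgt -sumc -sum_nat_const; apply: leq_sum => y /no.
  by rewrite -leqNgt.
exists (fun z => (z == y) + c z); split=> [z /[dup] zA /cA|].
  by have [->|] := eqVneq z y; lia.
rewrite big_split /= sumc (bigD1 y) //= eqxx big1 // => z /andP[_ /negPf->] //.
Qed.

(** With [a x = 0] and [a y = s - c y] on [A], the left side of the inequality at
    [x] is the sum of the [c y], chosen to be one more than the right side;
    the bounds on the size of [A] are what makes [1 <= c y <= s] possible.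
    The deficient neighbours of [x] are the elements of [A], so no [m] that
    vanishes on the star repairs the violation. *)
Lemma critical_exponent s x (A : {set V}) :
    is_tree G -> A \subset nbhd G x -> t <= #|A| <= t.-1 * s + 1 -> 0 < s ->
  exists a : V -> nat,
    (forall i, i \in x |: A -> star_cond s (fun z => (z == i) + a z)) /\
    (forall m : V -> nat, (forall i, i \in x |: A -> m i = 0) ->
       ~ star_cond s (fun z => m z + a z)).
Proof.
move=> treeG sA /andP[tA At] s_gt0.
have adjA y : y \in A -> adj G x y by move/(subsetP sA); rewrite inE.
have xA : x \notin A by apply/negP => /adjA; rewrite adj_irr.
have [|c [cA sumc]] := @bounded_weights A s (t.-1 * s + 1).
  rewrite At /= -(prednK t_gt0) in tA *; apply: leq_trans (_ : t.-1.+1 * s <= _).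
    by rewrite mulSn addnC leq_add2r.
  by rewrite leq_mul2r tA orbT.
pose a z := if z == x then 0 else if z \in A then s - c z else s.
have ax : a x = 0 by rewrite /a eqxx.
have aA y : y \in A -> a y = s - c y.
  by rewrite /a => yA; rewrite yA ifN //; apply: contraNneq xA => <-.
have aout y : y \notin x |: A -> a y = s.
  by rewrite in_setU1 /a negb_or => /andP[/negPf-> /negPf->].
exists a; split=> [i iS|m m0 /star_condP/(_ x)]; last first.
  rewrite m0 ?setU11 // ax subn0; apply/negP; rewrite -ltnNge.
  rewrite -addn1 -sumc; apply: leq_trans (leq_sum_subset _ sA).
  apply: leq_sum => y yA; have := cA y yA.
  by rewrite m0 ?in_setU1 ?yA ?orbT // aA //; lia.
apply/star_condP => z.
have [zS|/aout az] := boolP (z \in x |: A); last first.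
  by rewrite big1 // => y _; rewrite az; lia.
move: zS; rewrite in_setU1 => /predU1P[->|zA].
  have -> : \sum_(y in nbhd G x) (s - ((x == i) + a x + ((y == i) + a y))) =
            \sum_(y in A) (c y - ((x == i) + (y == i))).
    rewrite (sum_supported sA) => [|y]; last first.
      rewrite in_setD => /andP[yA xy]; rewrite (aout y).
        by lia.
      rewrite in_setU1 negb_or yA andbT.
      by apply: contraTneq xy => ->; rewrite inE adj_irr.
    by apply: eq_bigr => y yA; have := cA y yA; rewrite ax aA //; lia.
  (* Increasing [a x] lowers all [#|A| >= t] terms, and the right side only by
     [t - 1]. *)
  rewrite ax addn0; have [ex|xi] /= := eqVneq x i.
    have sumE : \sum_(y in A) (c y - (1 + (y == i))) + #|A| = t.-1 * s + 1.
      rewrite -sum1_card -big_split -sumc /=; apply: eq_bigr => y yA.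
      rewrite (_ : (y == i) = false); first by have := cA y yA; lia.
      by apply: contraNF xA => /eqP yi; rewrite ex -yi.
    move: sumE; rewrite mulnBr muln1.
    have : t.-1 <= t.-1 * s by rewrite leq_pmulr.
    lia.
  have iA : i \in A by move: iS; rewrite in_setU1 eq_sym (negPf xi).
  rewrite subn0 (bigD1 i) //= eqxx.
  move: sumc; rewrite (bigD1 i) //= => sumc.
  rewrite (eq_bigr c) => [|y /andP[_ /negPf ->]]; last by rewrite subn0.
  by have := cA i iA; lia.
(* At a leaf [z] of the star the only relevant neighbour is the centre.  For
   [1 < t] one neighbour never violates the inequality; for [t = 1] the star is
   a single edge and the inequality at [z] is the one at [x]. *)
have zx : adj G z x by rewrite adj_sym adjA.
rewrite (bigD1 x) /=; last by rewrite inE.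
rewrite big1 => [|y /andP[]]; last first.
  rewrite inE => zy yx; rewrite (aout y); first by lia.
  rewrite in_setU1 (negPf yx) /=; apply/negP => yA.
  by have := tree_triangle_free treeG (adjA z zA) (adjA y yA); rewrite zy.
rewrite addn0 ax addn0; have := cA z zA; rewrite aA //.
have [t1|t_gt1] := posnP t.-1; last first.
  move=> _; apply: leq_trans (leq_pmull _ t_gt1); lia.
have /card_le1_eqP A1 : #|A| <= 1 by move: At; rewrite t1.
have cz : c z = 1.
  by move: sumc; rewrite t1 (bigD1 z) //= big1 ?addn0 // => y /andP[yA /eqP[]]; apply: A1.
move=> _; rewrite t1 cz; move: iS; rewrite in_setU1 => /predU1P[->|iA].
  by rewrite eqxx; lia.
by rewrite (A1 i z iA zA) eqxx; lia.
Qed.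

End StarCondition.

(** * Induced stars *)

(** In a forest the neighbours of a vertex are pairwise non-adjacent, so a
    vertex and some of its neighbours always induce a star. *)
Lemma induced_star_iso (V : finType) (G : sgraph V) (S : {set V}) (r : nat) :
    is_tree G -> #|S| = r.+1 ->
  graph_iso (induced G S) (star r) <->
  exists (x : V) (A : {set V}), [/\ A \subset nbhd G x, S = x |: A & #|A| = r].
Proof.
move=> treeG cS; split=> [[f [g fK gK] fadj]|[x [A [sA SE cA]]]].
  pose x := val (g ord0); have xS : x \in S := valP (g ord0).
  exists x, (S :\ x); split; last 2 first.
  - by rewrite setD1K.
  - by move: cS; rewrite (cardsD1 x) xS => -[].
  apply/subsetP => y; rewrite !inE => /andP[yx yS].
  have := fadj (g ord0) (Sub y yS); rewrite /= /induced_adj /star_adj /= gK eqxx => <-.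
  by case: (eqVneq (f _) ord0) => // e; case/eqP: yx; rewrite /x -e fK.
have adjA y : y \in A -> adj G x y by move/(subsetP sA); rewrite inE.
have xA : x \notin A by apply/negP => /adjA; rewrite adj_irr.
have inA (z : {z | z \in S}) : val z != x -> val z \in A.
  have : val z \in x |: A by rewrite -SE (valP z).
  by rewrite in_setU1 => /predU1P[->|//]; rewrite eqxx.
pose f (z : {z | z \in S}) : 'I_r.+1 :=
  if val z == x then ord0 else inord (index (val z) (enum A)).+1.
have lt_index z : z \in A -> index z (enum A) < r.
  by rewrite -mem_enum -index_mem -cardE cA.
have f0 z : (f z == ord0) = (val z == x).
  rewrite /f; case: (eqVneq (val z) x) => [_|zx]; first by rewrite eqxx.
  by rewrite -val_eqE /= inordK // ltnS lt_index // inA.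
exists f.
  apply: inj_card_bij; last by rewrite card_ord card_sig -cS eq_leq.
  move=> y z e; apply: val_inj; have := f0 y; rewrite e f0.
  have [-> /esym/eqP|zx /esym/negbT yx] // := eqVneq (val z) x.
  move: e; rewrite /f (negPf zx) (negPf yx) => /(congr1 val).
  rewrite /= !inordK ?ltnS ?lt_index ?inA // => -[].
  by move=> /(congr1 (nth x (enum A))); rewrite !nth_index ?mem_enum ?inA.
move=> y z; rewrite /= /star_adj !f0 /induced_adj.
have [->|/inA yA] := eqVneq (val y) x; have [->|/inA zA] := eqVneq (val z) x.
- by rewrite adj_irr.
- by rewrite adjA.
- by rewrite adj_sym adjA.
by rewrite (tree_triangle_free treeG (adjA _ yA) (adjA _ zA)).
Qed.

(** * Monomial ideals and their associated primes *)

Import GRing.Theory.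
Local Open Scope ring_scope.
Local Open Scope classical_set_scope.

Section IdealGen.
Variable R : comNzRingType.
Implicit Types I P A : set R.

Lemma ideal_gen_is_ideal A : is_ideal (ideal_gen A).
Proof.
split=> [I [[] //]|f g fA gA I IA|a f fA I IA].
  by case: (IA) => -[_ addI _] _; apply: addI; [apply: fA | apply: gA].
by case: (IA) => -[_ _ mulI] _; apply: mulI; apply: fA.
Qed.

Lemma colon_principal I T f : is_ideal I -> colon I (ideal_gen [set T]) f <-> I (f * T).
Proof.
move=> [I0 addI mulI]; split=> [|fT g].
  by apply; apply: sub_gen_smallest.
move=> /(_ [set g | I (f * g)]); apply; split; last by move=> _ ->.
split=> [|g1 g2 /= h1 h2|a g1 /= h1]; rewrite /= ?mulr0 // ?mulrDr; first exact: addI.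
by rewrite mulrCA; apply: mulI.
Qed.

Lemma prime_ideal_is_ideal P : is_prime_ideal P -> is_ideal P.
Proof.
case=> -[]; rewrite !in_setE => P0 _ linP _.
have addP f g : P f -> P g -> P (f + g).
  by move=> /mem_set fP /mem_set gP; have := linP 1 f g fP gP; rewrite mul1r in_setE.
split=> // a f fP; have := linP a f 0 (mem_set fP).
by rewrite !in_setE addr0; apply.
Qed.

Lemma prime_idealP P : is_ideal P ->
  is_prime_ideal P <-> ~ P 1 /\ forall u v, P (u * v) -> P u \/ P v.
Proof.
move=> [P0 addP mulP]; split=> [[[_ P1 _] primeP]|[P1 primeP]].
  split; first by move=> /mem_set h; move: P1; rewrite h.
  move=> u v /mem_set /primeP /orP[]; rewrite in_setE; by [left | right].
split; last first.
  move=> u v; rewrite in_setE => /primeP [] h; apply/orP; [left|right]; exact: mem_set.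
split; rewrite ?in_setE //; first by apply/negP; rewrite in_setE.
by move=> a u v; rewrite !in_setE => hu hv; apply: addP => //; apply: mulP.
Qed.

Lemma prime_ideal_prod P (J : Type) (r : seq J) (F : J -> R) :
  is_prime_ideal P -> P (\prod_(i <- r) F i) -> exists i, P (F i).
Proof.
move=> primeP; have /(prime_idealP (prime_ideal_is_ideal primeP)) [P1 mulP] := primeP.
elim: r => [|i r IHr]; first by rewrite big_nil.
by rewrite big_cons => /mulP[|/IHr //]; exists i.
Qed.

Lemma prime_ideal_exp P x m : is_prime_ideal P -> P (x ^+ m) -> (0 < m)%N /\ P x.
Proof.
move=> primeP; have /(prime_idealP (prime_ideal_is_ideal primeP)) [P1 mulP] := primeP.
elim: m => [|m IHm]; first by rewrite expr0.
by rewrite exprS => /mulP[|/IHm[]].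
Qed.

End IdealGen.

Section MonomialIdeals.
Variables (k : fieldType) (n : nat).
Implicit Types (M : 'X_{1..n} -> Prop) (f g T : {mpoly k[n]}).
Implicit Types (I P : set {mpoly k[n]}) (S : {set 'I_n}).

Definition mono_ideal M : set {mpoly k[n]} :=
  [set f | forall m, m \in msupp f -> M m].

Definition upclosed M := forall m m' : 'X_{1..n}, M m -> M (m + m')%MM.

Lemma mono_idealX M m : mono_ideal M 'X_[m] <-> M m.
Proof.
split=> [|Mm m']; first by apply; rewrite msuppX mem_head.
by rewrite msuppX inE => /eqP ->.
Qed.

Lemma mono_ideal_is_ideal M : upclosed M -> is_ideal (mono_ideal M).
Proof.
move=> upM; split=> [m|f g fM gM m|a f fM m]; first by rewrite msupp0.
  by move=> /msuppD_le; rewrite mem_cat => /orP[/fM|/gM].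
move=> /msuppM_le /allpairsP [[m1 m2] /= [_ /fM Mm2 ->]].
by rewrite addmC; apply: upM.
Qed.

Lemma mono_ideal_sub M I : is_ideal I -> (forall m, M m -> I 'X_[m]) ->
  mono_ideal M `<=` I.
Proof.
move=> [I0 addI mulI] MI f fM; rewrite [f]mpolyE big_seq.
elim/big_ind: _ => // m /fM Mm; rewrite -mul_mpolyC.
by apply: mulI; apply: MI.
Qed.

Lemma ideal_mpolyX_lepm I (m m' : 'X_{1..n}) :
  is_ideal I -> (m <= m')%MM -> I 'X_[m] -> I 'X_[m'].
Proof. by move=> [_ _ mulI] /submK <- Im; rewrite mpolyXD; apply: mulI. Qed.

Lemma split_msupp M f : exists g h, [/\ f = g + h,
  forall m, m \in msupp g -> M m &
  forall m, m \in msupp h -> ~ M m].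
Proof.
pose part (Q : pred 'X_{1..n}) := \sum_(m <- msupp f | Q m) f@_m *: 'X_[m].
have part_supp Q m : m \in msupp (part Q) -> Q m.
  move=> /msupp_sum_le /flatten_mapP [m']; rewrite mem_filter => /andP[Qm' _].
  by move=> /msuppZ_le; rewrite msuppX inE => /eqP ->.
exists (part (fun m => `[< M m >])), (part (fun m => ~~ `[< M m >])).
split=> [|m /part_supp /asboolP //|m /part_supp /asboolPn //].
by rewrite {1}[f]mpolyE (bigID (fun m => `[< M m >])).
Qed.

Definition hits S (m : 'X_{1..n}) : Prop := exists2 i, i \in S & (0 < m i)%N.

Lemma hits_upclosed S : upclosed (hits S).
Proof. by move=> m m' [i iS mi]; exists i; rewrite // mnmDE addn_gt0 mi. Qed.

Lemma var_idealE S : var_ideal k S = mono_ideal (hits S).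
Proof.
apply/seteqP; split.
  apply: smallest_sub; first exact/mono_ideal_is_ideal/hits_upclosed.
  by move=> _ [i iS ->]; apply/mono_idealX; exists i; rewrite // mnm1E eqxx.
apply: mono_ideal_sub (@ideal_gen_is_ideal _ _) _ => m [i iS mi].
apply: (ideal_mpolyX_lepm (m := U_(i)%MM) (@ideal_gen_is_ideal _ _)).
  by apply/mnm_lepP => j; rewrite mnm1E; case: eqP => // <-.
by apply: sub_gen_smallest; exists i.
Qed.

(** Used to reduce modulo [var_ideal k S] to a polynomial whose leading monomial
    avoids [S]. *)
Lemma avoiding_part S f : exists g h, [/\ f = g + h, var_ideal k S g &
  forall m, m \in msupp h -> ~ hits S m].
Proof. by rewrite var_idealE; apply: split_msupp. Qed.

(** Modulo [var_ideal k S] two non-members may be taken with leading monomials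
    avoiding [S]; the leading monomial of their product then avoids [S] too. *)
Lemma var_ideal_prime S : is_prime_ideal (var_ideal k S).
Proof.
have idP : is_ideal (var_ideal k S) := @ideal_gen_is_ideal _ _.
apply/(prime_idealP idP); split.
  rewrite var_idealE -mpolyX0 => /mono_idealX [i _].
  by rewrite mnm0E.
case: (idP) => _ addP mulP u v uv.
have [u1 [u2 [eu Pu1 Su2]]] := avoiding_part S u.
have [v1 [v2 [ev Pv1 Sv2]]] := avoiding_part S v.
have [u0|nzu] := eqVneq u2 0; first by left; rewrite eu u0 addr0.
have [v0|nzv] := eqVneq v2 0; first by right; rewrite ev v0 addr0.
have : var_ideal k S (u2 * v2).
  have -> : u2 * v2 = u * v + (- v2 * u1 + - u * v1) by rewrite eu ev; ring.
  by apply: (addP) => //; apply: (addP); apply: (mulP).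
have nzuv : u2 * v2 != 0 by rewrite mulf_neq0.
rewrite var_idealE => /(_ _ (mlead_supp nzuv)) [i iS].
rewrite mleadM // mnmDE addn_gt0 => /orP[mi|mi].
  by case: (Su2 _ (mlead_supp nzu)); exists i.
by case: (Sv2 _ (mlead_supp nzv)); exists i.
Qed.

(** Suppose [f * T] lies in the ideal and let a be the leading exponent of [f].
    Call an exponent m stable when no m + K a is in [M].  A large power of X^a
    moves the unstable part [h] of [T] into the ideal, hence also [f] times its
    stable part [g]; but the leading exponent of the product with [g] is m + K' a
    with m stable, so [g] must vanish. *)
Lemma colon_mlead M T f : upclosed M -> mono_ideal M (f * T) -> f != 0 ->
  exists K, mono_ideal M ('X_[mlead f *+ K] * T).
Proof.
move=> upM fT nzf; have [I0 addI mulI] := mono_ideal_is_ideal upM.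
pose a := mlead f.
have upK m K K' : (K <= K')%N -> M (m + a *+ K)%MM -> M (m + a *+ K')%MM.
  move=> /subnKC <- /upM MK.
  have -> : (m + a *+ (K + (K' - K)) = m + a *+ K + a *+ (K' - K))%MM.
    by apply/mnmP => i; rewrite !mnmDE !mulmnE mulnDr addnA.
  exact: MK.
have [g [h [eT gM hM]]] :=
  split_msupp (fun m => forall K, ~ M (m + a *+ K)%MM) T.
have [K hK] : exists K, forall m, m \in msupp h -> M (m + a *+ K)%MM.
  elim: (msupp h) hM => [|m r IHr] hM; first by exists 0%N.
  have [m' m'r|K hK] := IHr; first by apply: hM; rewrite inE m'r orbT.
  have /existsNP [K' /contrapT hK'] := hM m (mem_head _ _).
  exists (maxn K K') => m'; rewrite inE => /predU1P[->|/hK].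
    by apply: (upK _ _ _ _ hK'); apply: leq_maxr.
  by apply: upK; apply: leq_maxl.
have Kh : mono_ideal M ('X_[a *+ K] * h).
  rewrite mulrC => m; rewrite (perm_mem (msuppMX _ _)) => /mapP [m' /hK + ->].
  by rewrite addmC.
have [g0|nzg] := eqVneq g 0; first by exists K; rewrite eT g0 add0r.
have nzX : 'X_[a *+ K] != 0 :> {mpoly k[n]}.
  by rewrite -msupp_eq0 msuppX.
have nzfg : f * g != 0 by rewrite mulf_neq0.
have nzXfg : 'X_[a *+ K] * (f * g) != 0 by rewrite mulf_neq0.
have /(_ _ (mlead_supp nzXfg)) : mono_ideal M ('X_[a *+ K] * (f * g)).
  have -> : 'X_[a *+ K] * (f * g) =
      'X_[a *+ K] * (f * T) + (- f) * ('X_[a *+ K] * h) by rewrite eT; ring.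
  by apply: (addI); apply: (mulI).
rewrite !mleadM // mleadXm => Mlead.
case: (gM _ (mlead_supp nzg) K.+1); rewrite mulmS.
have <- // : (a *+ K + (a + mlead g) = mlead g + (a + a *+ K))%MM.
by apply/mnmP => i; rewrite !mnmDE; lia.
Qed.

Lemma prime_ideal_mpolyX P m :
  is_prime_ideal P -> P 'X_[m] -> exists2 i, (0 < m i)%N & P 'X_i.
Proof.
move=> primeP; rewrite mpolyXE_id => /(prime_ideal_prod primeP) [i].
by move=> /(prime_ideal_exp primeP) [mi Pi]; exists i.
Qed.

(** [S] is the set of variables in [P].  An element of [P] outside
    [var_ideal k S] could be taken to avoid [S]; by [colon_mlead] a power of its
    leading monomial would be in [P], hence so would one of the variables of
    that monomial, contradicting the choice of [S]. *)
Lemma associated_prime_monomial M P T : upclosed M -> is_prime_ideal P ->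
    P = colon (mono_ideal M) (ideal_gen [set T]) ->
  exists S, P = var_ideal k S.
Proof.
move=> upM primeP PE; have idM := mono_ideal_is_ideal upM.
have PT f : P f <-> mono_ideal M (f * T) by rewrite PE; apply: colon_principal.
have [P0 addP mulP] := prime_ideal_is_ideal primeP.
pose S := [set i | `[< P 'X_i >]]%SET.
have SP : var_ideal k S `<=` P.
  apply: smallest_sub; first exact: prime_ideal_is_ideal.
  by move=> _ [i + ->]; rewrite inE => /asboolP.
exists S; apply/seteqP; split=> // f Pf.
have [g [h [ef Sg hS]]] := avoiding_part S f.
have [h0|nzh] := eqVneq h 0; first by rewrite ef h0 addr0.
have /PT /(colon_mlead upM)/(_ nzh) [K /PT] : P h.
  have -> : h = f + (-1) * g by rewrite ef; ring.
  by apply: (addP) => //; apply: (mulP); apply: SP.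
move=> /(prime_ideal_mpolyX primeP) [i]; rewrite mulmnE muln_gt0 => /andP[mi _] Pi.
by case: (hS _ (mlead_supp nzh)); exists i => //; rewrite inE; apply/asboolP.
Qed.

End MonomialIdeals.

(** * Powers of the partial cover ideal *)

Section Powers.
Variables (k : fieldType) (n t : nat) (G : sgraph 'I_n).

Lemma meets_stars_upclosed : upclosed (fun m => meets_stars G t m).
Proof.
move=> m m' cm x A sA cA; have [y yA my] := cm x A sA cA.
by exists y; rewrite // mnmDE addn_gt0 my.
Qed.

Lemma star_cond_upclosed s : upclosed (fun m => star_cond G t s m).
Proof.
by move=> m m'; apply: star_condW => x; rewrite mnmDE leq_addr.
Qed.

Lemma partial_cover_idealE :
  partial_cover_ideal k t G = mono_ideal (fun m => meets_stars G t m).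
Proof.
apply/seteqP; split=> f fJ.
  move=> m mf x A sA cA.
  by have := fJ x I A (conj sA cA); rewrite var_idealE => /(_ m mf).
move=> x _ A [sA cA]; rewrite var_idealE => m mf.
exact: fJ.
Qed.

Hypotheses (t_gt0 : (0 < t)%N) (treeG : is_tree G).

Lemma power_mpolyX s (C : 'I_s -> {set 'I_n}) (m : 'X_{1..n}) :
    (forall j, meets_stars G t (fun x => x \in C j)) ->
    (forall x, \sum_(j < s) (x \in C j) <= m x)%N ->
  ideal_exp (partial_cover_ideal k t G) s 'X_[m].
Proof.
elim: s C m => [//|s IHs] C m coverC leC.
pose c := [multinom nat_of_bool (x \in C ord0) | x < n].
have le_cm : (c <= m)%MM.
  apply/mnm_lepP => x; apply: leq_trans (leC x).
  by rewrite mnmE big_ord_recl leq_addr.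
rewrite -(submK le_cm) addmC mpolyXD; apply: sub_gen_smallest.
exists 'X_[c], 'X_[m - c]; split=> //.
  rewrite partial_cover_idealE; apply/mono_idealX => x A sA cA.
  by have [y yA yC] := coverC ord0 x A sA cA; exists y; rewrite // mnmE.
apply: (IHs (fun j => C (lift ord0 j))) => // x.
by rewrite mnmBE mnmE leq_subRL; have := leC x; rewrite big_ord_recl //; lia.
Qed.

(** One inclusion holds because the inequalities add up along products; the
    other is [star_cond_decomposition]. *)
Lemma power_partial_cover_ideal s :
  ideal_exp (partial_cover_ideal k t G) s = mono_ideal (fun m => star_cond G t s m).
Proof.
apply/seteqP; split; last first.
  apply: mono_ideal_sub; first by case: s => [|s]; [split | apply: ideal_gen_is_ideal].
  by move=> m /(star_cond_decomposition t_gt0 treeG) [C [covC leC]]; apply: power_mpolyX leC.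
elim: s => [|s IHs]; first by move=> f _ m _ x A _; rewrite muln0.
apply: smallest_sub; first exact/mono_ideal_is_ideal/star_cond_upclosed.
move=> _ [f [g [fJ /IHs gJ ->]]] m /msuppM_le /allpairsP [[m1 m2] /= [/= m1f m2g ->]].
have : star_cond G t (1 + s) (fun x => m1 x + m2 x)%N.
  apply: star_condD (gJ _ m2g); apply: meets_stars_cond => //.
  by move: fJ; rewrite partial_cover_idealE; apply.
by apply: star_condW => x; rewrite mnmDE.
Qed.

Lemma star_cond_add1 s (m : 'X_{1..n}) i :
  star_cond G t s (fun z => (z == i) + m z)%N <-> star_cond G t s (m + U_(i))%MM.
Proof. by split; apply: star_condW => z; rewrite mnmDE mnm1E eq_sym addnC. Qed.

(** Multiplying [T] by a large monomial [w] in the variables outside [S] does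
    not move it into the ideal, as [w] is not in the prime.  So some exponent m
    of [T] has m + w outside the ideal, and m + w is critical for [S]. *)
Lemma associated_prime_star s P : Ass (ideal_exp (partial_cover_ideal k t G) s) P ->
  exists (x : 'I_n) (A : {set 'I_n}),
    [/\ A \subset nbhd G x, P = var_ideal k (x |: A)%SET &
        (t <= #|A| <= t.-1 * s + 1)%N].
Proof.
rewrite power_partial_cover_ideal => -[primeP [T PT]].
have upM := @star_cond_upclosed s.
have [S PS] := associated_prime_monomial upM primeP PT.
have PE f : P f <-> mono_ideal (fun m => star_cond G t s m) (f * T).
  by rewrite PT; apply/colon_principal/mono_ideal_is_ideal.
pose w := [multinom (if x \in S then 0 else s)%N | x < n].
have nPw : ~ P 'X_[w].
  by rewrite PS var_idealE => /mono_idealX [i iS]; rewrite mnmE iS.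
have [m mT nMm] : exists2 m, m \in msupp T & ~ star_cond G t s (m + w)%MM.
  apply: contra_notP nPw => noT; apply/PE; rewrite mulrC => m'.
  rewrite (perm_mem (msuppMX _ _)) => /mapP [m mT ->].
  by apply: contrapT => nM; apply: noT; exists m => //; rewrite addmC.
have [x [A [sA SE cA]]] : exists (x : 'I_n) (A : {set 'I_n}),
    [/\ A \subset nbhd G x, S = x |: A & t <= #|A| <= t.-1 * s + 1]%N.
  apply: critical_star nMm => // [i iS|j jS]; last first.
    by rewrite mnmDE mnmE (negPf jS) leq_addl.
  apply/star_cond_add1; rewrite -addmA [(w + _)%MM]addmC addmA; apply: (upM).
  have /PE : P 'X_i.
    by rewrite PS var_idealE; apply/mono_idealX; exists i; rewrite // mnm1E eqxx.
  rewrite mulrC; apply; rewrite (perm_mem (msuppMX _ _)).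
  by apply/mapP; exists m => //; rewrite addmC.
by exists x, A; rewrite -SE.
Qed.

Lemma star_associated_prime s (x : 'I_n) (A : {set 'I_n}) : (0 < s)%N ->
    A \subset nbhd G x -> (t <= #|A| <= t.-1 * s + 1)%N ->
  Ass (ideal_exp (partial_cover_ideal k t G) s) (var_ideal k (x |: A)%SET).
Proof.
move=> s_gt0 sA cA; rewrite power_partial_cover_ideal.
have [a [satS unsat]] := critical_exponent t_gt0 treeG sA cA s_gt0.
split; first exact: var_ideal_prime.
exists 'X_[[multinom a z | z < n]]; have upM := @star_cond_upclosed s.
apply/seteqP; split=> f; rewrite colon_principal; try exact: mono_ideal_is_ideal.
  rewrite var_idealE => fS m'.
  rewrite (perm_mem (msuppMX _ _)) => /mapP [m1 /fS [i iS mi] ->].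
  move: iS => /satS; apply: star_condW => z.
  by rewrite mnmDE mnmE addnC leq_add2l; case: eqP => // ->.
rewrite var_idealE => fS m mf; apply: contrapT => nh; case: (unsat m).
  move=> i iS; apply/eqP; rewrite -leqn0 leqNgt; apply/negP => mi.
  by apply: nh; exists i.
apply: star_condW (fS ([multinom a z | z < n] + m)%MM _) => [z|].
  by rewrite mnmDE mnmE addnC.
by rewrite (perm_mem (msuppMX _ _)); apply/mapP; exists m.
Qed.

End Powers.

Theorem theorem4p1 (k : fieldType) (n t : nat) (Gamma : sgraph 'I_n)
    (ht : (1 <= t)%N) (hGamma : is_tree Gamma) :
  forall s : nat, (1 <= s)%N ->
    Ass (ideal_exp (partial_cover_ideal k t Gamma) s) =
    [set P : set {mpoly k[n]} | exists (r : nat) (S : {set 'I_n}),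
       [/\ #|S| = r.+1, P = var_ideal k S,
           graph_iso (induced Gamma S) (star r) &
           (t <= r <= minn n (s * (t - 1) + 1))%N]].
Proof.
move=> s hs; apply/seteqP; split=> P.
  move=> /(associated_prime_star ht hGamma) [x [A [sA -> /andP[tA At]]]].
  have xA : x \notin A by apply/negP => /(subsetP sA); rewrite inE adj_irr.
  have cS : #|(x |: A)%SET| = #|A|.+1 by rewrite cardsU1 xA.
  exists #|A|, (x |: A)%SET; split=> //.
    by apply/(induced_star_iso hGamma cS); exists x, A.
  rewrite tA leq_min subn1 mulnC At andbT ltnW //.
  by rewrite -cS -[X in (_ <= X)%N]card_ord max_card.
move=> [r [S [cS -> /(induced_star_iso hGamma cS) [x [A [sA -> cA]]] /andP[tr]]]].
rewrite leq_min subn1 mulnC => /andP[_ rt].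
by apply: star_associated_prime; rewrite // cA tr.
Qed.
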